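(* Let $(W,S)$ be an arbitrary Coxeter system and let $\omega$ be a finite word in the generators $S$. The $\omega$-sorting order on $W_\omega$ is a maximal lattice with respect to the addition of any collection of Bruhat cover relations: if $C$ is any nonempty collection of pairs $(u,w)\in W_\omega\times W_\omega$ such that $w=ut$ for some reflection $t$, $\ell(w)=\ell(u)+1$, and $u\not\leq_\omega w$, then the poset on $W_\omega$ obtained from the $\omega$-sorting order by adding the relations $u\prec w$ for all $(u,w)\in C$ (and taking the transitive closure) is not a lattice.
   Context: $\ell$ denotes the length function of $(W,S)$; the reflections are the elements of $T=\{wsw^{-1}:w\in W,\ s\in S\}$. Let $\omega=(\omega_1,\dots,\omega_m)$. A subword $\alpha\subseteq\omega$ is identified with its index set $I(\alpha)=\{i_1<\dots<i_k\}\subseteq I(\omega)=\{1,\dots,m\}$, with $\alpha=(\omega_{i_1},\dots,\omega_{i_k})$. For a word $\alpha=(\alpha_1,\dots,\alpha_k)$ write $\langle\alpha\rangle=\alpha_1\cdots\alpha_k\in W$; $\alpha$ is reduced if $k=\ell(\langle\alpha\rangle)$. $W_\omega\subseteq W$ is the set of elements $\langle\alpha\rangle$ for subwords $\alpha\subseteq\omega$. For $A,B\subseteq I(\omega)$, $A\leq_{\mathsf{lex}}B$ means $A=B$ or $\min((A\cup B)\setminus(A\cap B))\in A$. For $u\in W_\omega$, the $\omega$-sorted word $\mathsf{sort}_\omega(u)$ is the subword of $\omega$ whose index set is $\leq_{\mathsf{lex}}$-minimum among index sets of subwords of $\omega$ that are reduced words for $u$. The $\omega$-sorting order on $W_\omega$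 is: $u\leq_\omega w$ iff $I(\mathsf{sort}_\omega(u))\subseteq I(\mathsf{sort}_\omega(w))$. It is a lattice graded by $\ell$. *)

(* Defs.v *)
From HB Require Import structures.
From mathcomp Require Import all_boot.
From mathcomp Require Import boolp classical_sets.
From Stdlib Require Relation_Definitions Relation_Operators.

Set Implicit Arguments.
Unset Strict Implicit.
Unset Printing Implicit Defensive.

Local Open Scope group_scope.
Local Open Scope classical_set_scope.

Definition wprod (W : groupType) (a : seq W) : W := \prod_(s <- a) s.

Definition word_in (W : groupType) (S : set W) (a : seq W) : Prop :=
  forall s, s \in a -> S s.

Definition has_order (W : groupType) (x : W) (n : nat) : Prop :=
  [/\ (0 < n)%N, x ^+ n = 1 & forall k, (0 < k < n)%N -> x ^+ k <> 1].

(* [W] is generated by the set [S] of elements of order 2, and has the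
   presentation with generators [S] and relations (s s')^m(s,s') = 1, where
   m(s,s') is the order of s s', for all s, s' in S for which it is finite.
   Words without inverses suffice in [cox_gen] since s^-1 = s for s in S.
   [cox_pres] is the existence half of the universal property of the
   presentation; the uniqueness half is a consequence of [cox_gen]. *)
Record coxeter_system (W : groupType) (S : set W) : Prop := CoxeterSystem {
  cox_invol : forall s, S s -> has_order s 2;
  cox_gen : forall x : W, exists2 a : seq W, word_in S a & wprod a = x;
  cox_pres : forall (G : groupType) (f : W -> G),
    (forall s s' n, S s -> S s' -> has_order (s * s') n ->
       (f s * f s') ^+ n = 1) ->
    exists phi : {multiplicative W -> G}, forall s, S s -> phi s = f s
}.

Definition is_word_length (W : groupType) (S : set W) (x : W) : pred nat :=
  fun n => `[< exists a : seq W, [/\ size a = n, word_in S a & wprod a = x] >].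

(* The default value is only used when [x] is not a product of elements of
   [S], which does not occur in a Coxeter system. *)
Definition cox_length (W : groupType) (S : set W) (x : W) : nat :=
  match pselect (exists n, is_word_length S x n) with
  | left ex_n => ex_minn ex_n
  | right _ => 0%N
  end.

Definition reflections (W : groupType) (S : set W) : set W :=
  [set t | exists w s, S s /\ t = w * s * w^-1].

Definition bruhat_cover (W : groupType) (S : set W) (u w : W) : Prop :=
  (exists2 t, reflections S t & w = u * t)
  /\ cox_length S w = (cox_length S u).+1.

(* A subword of [omega : m.-tuple W] is given by its index set [A : {set 'I_m}];
indices start at 0. *)

(* [enum A] lists the elements of [A] in increasing order. *)
Definition subword (W : groupType) (m : nat) (omega : m.-tuple W)
  (A : {set 'I_m}) : seq W := [seq tnth omega i | i <- enum A].

Definition reduced (W : groupType) (S : set W) (a : seq W) : bool :=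
  size a == cox_length S (wprod a).

Definition lex_le (m : nat) (A B : {set 'I_m}) : bool :=
  let D := (A :|: B) :\: (A :&: B) in
  (A == B) || [exists i, [&& i \in D, [forall j in D, (i <= j)%N] & i \in A]].

Definition reduced_for (W : groupType) (S : set W) (m : nat)
  (omega : m.-tuple W) (u : W) (A : {set 'I_m}) : bool :=
  reduced S (subword omega A) && (wprod (subword omega A) == u).

Definition sort_spec (W : groupType) (S : set W) (m : nat)
  (omega : m.-tuple W) (u : W) (A : {set 'I_m}) : bool :=
  reduced_for S omega u A
  && [forall B : {set 'I_m}, reduced_for S omega u B ==> lex_le A B].

(* The index set of the sorted word of [u].  The default value is only used
   when no subword of [omega] is a reduced word for [u]; in a Coxeter system
   every element of [W_omega] has such a subword. *)
Definition sort_idx (W : groupType) (S : set W) (m : nat)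
  (omega : m.-tuple W) (u : W) : {set 'I_m} :=
  odflt finset.set0 [pick A | sort_spec S omega u A].

Definition subword_products (W : groupType) (m : nat) (omega : m.-tuple W) :
  pred W := fun u => [exists A : {set 'I_m}, wprod (subword omega A) == u].

Definition W_ (W : groupType) (m : nat) (omega : m.-tuple W) : Type :=
  {u : W | subword_products omega u}.

Definition sorting_le (W : groupType) (S : set W) (m : nat)
  (omega : m.-tuple W) (u w : W_ omega) : Prop :=
  sort_idx S omega (sval u) \subset sort_idx S omega (sval w).
Arguments sorting_le {W} S {m omega} u w.

Definition is_poset (T : Type) (R : T -> T -> Prop) : Prop :=
  Relation_Definitions.order T R.

Definition is_join (T : Type) (R : T -> T -> Prop) (x y z : T) : Prop :=
  [/\ R x z, R y z & forall v, R x v -> R y v -> R z v].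

Definition is_meet (T : Type) (R : T -> T -> Prop) (x y z : T) : Prop :=
  [/\ R z x, R z y & forall v, R v x -> R v y -> R v z].

Definition is_lattice (T : Type) (R : T -> T -> Prop) : Prop :=
  [/\ is_poset R, forall x y, exists z, is_join R x y z
    & forall x y, exists z, is_meet R x y z].

Definition add_relations (T : Type) (R : T -> T -> Prop) (C : set (T * T)) :
  T -> T -> Prop :=
  Relation_Operators.clos_trans T (fun x y => R x y \/ C (x, y)).

(* Main.v *)
(* Call a set A of positions sorted if, for every position j, the letter at j is
   not a left descent of the product of the letters of A strictly after j.  For
   j in A this says that A is reduced, for j outside A that the choice of
   positions is greedy, hence lexicographically first; so the sorted sets are
   exactly the index sets of the sorted words.

   The sorted sets form a supersolvable antimatroid: if A and B are sorted and
   x = min (B \ A), then A + x is sorted.  Otherwise take the last bad position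
   j, with letter s.  If p is the product of the letters of A between j and x,
   then s p = p x (identifying x with its letter).  The product of the letters
   of B after j up to x, x included, does not have s as a left descent and lies
   below p x = s p in Bruhat order, hence below p; but then the greedy choice of
   B is over before x, a contradiction.

   Hence the sorted sets are closed under union, and they form a lattice.  If
   (u, w) is an added relation with u of least rank and y = min (w \ u), then u
   and the prefix of w ending at y have both w and u + y as upper bounds, one
   rank above u, which prevents the existence of a join. *)

From HB Require Import structures.
Require Import Defs.
From mathcomp Require Import all_boot.
From mathcomp Require Import boolp classical_sets.
From mathcomp Require Import zify.
From Stdlib Require Relation_Definitions Relation_Operators.

Set Implicit Arguments.
Unset Strict Implicit.
Unset Printing Implicit Defensive.

Local Open Scope classical_set_scope.
Local Open Scope group_scope.

(** The group of boolean functions on [W] under pointwise [addb], extended by [W] acting through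
    conjugation; the first component will record an inversion set. *)
Definition set_sdprod (W : groupType) : Type := ((W -> bool) * W)%type.

(** * Inversions and the exchange property *)

Section SetSdprod.
Variable W : groupType.
Implicit Types x y z : set_sdprod W.

Definition sdp_one : set_sdprod W := (fun=> false, 1).
Definition sdp_mul x y : set_sdprod W :=
  (fun t => x.1 t (+) y.1 (t ^ x.2), x.2 * y.2).
Definition sdp_inv x : set_sdprod W := (fun t => x.1 (t ^ x.2^-1), x.2^-1).

Lemma sdp_mulA : associative sdp_mul.
Proof.
move=> x y z; congr (_, _); last exact: mulgA.
by apply/funext => t /=; rewrite conjgM addbA.
Qed.

Lemma sdp_mul1 : left_id sdp_one sdp_mul.
Proof.
by case=> A u; congr (_, _); [apply/funext => t /=; rewrite conjg1 | exact: mul1g].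
Qed.

Lemma sdp_mulr1 : right_id sdp_one sdp_mul.
Proof.
by case=> A u; congr (_, _); [apply/funext => t /=; rewrite addbF | exact: mulg1].
Qed.

Lemma sdp_mulV : left_inverse sdp_one sdp_inv sdp_mul.
Proof.
by case=> A u; congr (_, _); [apply/funext => t /=; rewrite addbb | exact: mulVg].
Qed.

Lemma sdp_mulrV : right_inverse sdp_one sdp_inv sdp_mul.
Proof.
case=> A u; congr (_, _); last exact: mulgV.
by apply/funext => t /=; rewrite conjgK addbb.
Qed.

HB.instance Definition _ := gen_eqMixin (set_sdprod W).
HB.instance Definition _ := gen_choiceMixin (set_sdprod W).
HB.instance Definition _ := isGroup.Build (set_sdprod W)
  sdp_mulA sdp_mul1 sdp_mulr1 sdp_mulV sdp_mulrV.

End SetSdprod.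

Section Coxeter.
Variables (W : groupType) (S : set W).
Hypothesis coxS : coxeter_system S.
Implicit Types (s t u v w x : W) (a b c : seq W).

Lemma cox_sq s : S s -> s * s = 1.
Proof. by move=> /(cox_invol coxS) [_ +] _; rewrite expg2. Qed.

Lemma cox_inv s : S s -> s^-1 = s.
Proof. by move=> Ss; apply: mulg1_eq; apply: cox_sq. Qed.

Lemma cox_mulK s w : S s -> s * (s * w) = w.
Proof. by move=> Ss; rewrite mulgA cox_sq// mul1g. Qed.

Lemma genJ_eq s t : S s -> (s * t * s == s) = (t == s).
Proof.
move=> Ss; rewrite -(inj_eq (mulgI s)) -(inj_eq (mulIg s)).
by rewrite !mulgA cox_sq// mul1g -mulgA cox_sq// mulg1 mul1g.
Qed.

Definition gen_sdp s : set_sdprod W := (fun t => t == s, s).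

(** The elements [(s * s') ^+ k * s] are the reflections met along an alternating word in [s] and
    [s'], one for each of its [n.*2] letters. *)
Lemma gen_sdpX s s' n : S s -> S s' ->
  (gen_sdp s * gen_sdp s') ^+ n =
  (fun t => \big[addb/false]_(0 <= k < n.*2) (t == (s * s') ^+ k * s),
   (s * s') ^+ n).
Proof.
move=> Ss Ss'; elim: n => [|n IH].
  by rewrite !expg0; congr (_, _); apply/funext => t; rewrite big_nil.
rewrite expgSr IH; congr (_, _); last by rewrite expgSr.
apply/funext => t /=; rewrite doubleS !big_nat_recr//= -addbA; congr (_ (+) _).
set g := s * s'.
have gs k : s * (g ^+ k)^-1 = g ^+ k * s.
  elim: k => [|k IHk]; first by rewrite expg0 mul1g invg1 mulg1.
  rewrite expgSr invgM mulgA [s * g^-1](_ : _ = g * s); first last.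
    by rewrite invgM !cox_inv// mulgA.
  by rewrite -mulgA IHk mulgA -expgS expgSr.
have E (x y z : W) : (z ^ x == y) = (z == x * (y * x^-1)).
  have -> : x * (y * x^-1) = y ^ x^-1 by rewrite conjgE invgK.
  by rewrite -(inj_eq (@conjg_inj _ x)) conjgKV.
rewrite !E gs (cox_inv Ss) [s * (s' * s)]mulgA -/g -mulgA gs !mulgA.
by rewrite -(mulgA _ s) -/g -expgSr -!expgnDr addnn addSn addnn.
Qed.

(* [N w t] holds iff [t] is a left inversion of [w]; the cocycle is obtained from
   the universal property, applied to the semidirect product of the boolean
   functions on [W] by [W]. *)
Lemma inversions_exist : exists N : W -> W -> bool,
  (forall s t, S s -> N s t = (t == s)) /\
  (forall u v t, N (u * v) t = N u t (+) N v (t ^ u)).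
Proof.
have [s s' n Ss Ss' [_ gn1 _]|phi phiS] := cox_pres coxS (f := gen_sdp).
  rewrite gen_sdpX// gn1; congr (_, _); apply/funext => t /=.
  (* As [(s * s') ^+ n = 1], the upper half of the range repeats the lower half and cancels it. *)
  rewrite -addnn (big_cat_nat (n := n)) ?leq_addr//= -{2}[n]add0n big_addn addnK.
  under [X in _ (+) X]eq_bigr do rewrite expgnDr gn1 mulg1.
  by rewrite addbb.
have phi1 : phi 1 = 1 by apply: (mulgI (phi 1)); rewrite -gmulfM !mulg1.
have phi2 w : (phi w).2 = w.
  have [a aS <-] := cox_gen coxS w; rewrite /wprod.
  elim: a aS => [|s a IH] aS; first by rewrite !big_nil phi1.
  rewrite !big_cons gmulfM /= IH ?phiS//; first by apply: aS; rewrite inE eqxx.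
  by move=> r ra; apply: aS; rewrite inE ra orbT.
exists (fun w => (phi w).1); split=> [s t Ss|u v t]; first by rewrite phiS.
by rewrite gmulfM /= phi2.
Qed.

Lemma word_in_cons s a : word_in S (s :: a) <-> S s /\ word_in S a.
Proof.
split=> [aS|[Ss aS] r]; last by rewrite inE => /predU1P[->|/aS].
by split=> [|r ra]; apply: aS; rewrite inE ?eqxx// ra orbT.
Qed.

Lemma word_in_cat a b : word_in S (a ++ b) <-> word_in S a /\ word_in S b.
Proof.
split=> [abS|[aS bS] r]; last by rewrite mem_cat => /orP[/aS|/bS].
by split=> r ra; apply: abS; rewrite mem_cat ra ?orbT.
Qed.

Lemma word_in_subseq a b : subseq a b -> word_in S b -> word_in S a.
Proof. by move=> sab bS s /(mem_subseq sab)/bS. Qed.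

Lemma wprod_cat a b : wprod (a ++ b) = wprod a * wprod b.
Proof. by rewrite /wprod big_cat. Qed.

Lemma wprod_cons s a : wprod (s :: a) = s * wprod a.
Proof. by rewrite /wprod big_cons. Qed.

Lemma wprod_nil : wprod [::] = 1 :> W.
Proof. by rewrite /wprod big_nil. Qed.

Lemma cox_length_word w :
  exists a, [/\ size a = cox_length S w, word_in S a & wprod a = w].
Proof.
rewrite /cox_length; case: pselect => [ex_n|[]]; last first.
  have [a aS aw] := cox_gen coxS w.
  by exists (size a); apply/asboolP; exists a.
by case: ex_minnP => n /asboolP.
Qed.

Lemma cox_length_le a : word_in S a -> (cox_length S (wprod a) <= size a)%N.
Proof.
move=> aS; rewrite /cox_length; case: pselect => // ex_n.
by case: ex_minnP => n _; apply; apply/asboolP; exists a.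
Qed.

Lemma cox_length1 : cox_length S 1 = 0%N.
Proof. by apply/eqP; rewrite -leqn0 -wprod_nil; apply: cox_length_le. Qed.

Lemma cox_lengthM_le u v :
  (cox_length S (u * v)%g <= cox_length S u + cox_length S v)%N.
Proof.
have [a [<- aS <-]] := cox_length_word u; have [b [<- bS <-]] := cox_length_word v.
by rewrite -wprod_cat -size_cat; apply: cox_length_le; apply/word_in_cat.
Qed.

Lemma reflections_gen s : S s -> reflections S s.
Proof. by move=> Ss; exists 1, s; rewrite mul1g invg1 mulg1. Qed.

Lemma reflections_conj t x : reflections S t -> reflections S (x * t * x^-1).
Proof.
by case=> y [s [Ss ->]]; exists (x * y), s; rewrite invgM !mulgA.
Qed.

Lemma reflections_sq t : reflections S t -> t * t = 1.
Proof.
case=> x [s [Ss ->]].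
by rewrite -!mulgA mulKg [s * (s * _)]cox_mulK// mulgV.
Qed.

Lemma reflections_mulK t w : reflections S t -> t * (t * w) = w.
Proof. by move=> Tt; rewrite mulgA reflections_sq// mul1g. Qed.

Section Inversions.
Variable N : W -> W -> bool.
Hypothesis inv_gen : forall s t, S s -> N s t = (t == s).
Hypothesis invM : forall u v t, N (u * v) t = N u t (+) N v (t ^ u).

Lemma inv_1 t : N 1 t = false.
Proof.
have := invM 1 1 t; rewrite mulg1 conjg1 => /eqP.
by case: (N 1 t).
Qed.

(** For [t = x * s * x^-1] the contributions of [x] and [x^-1] cancel, since [1] has no inversions;
    the middle letter contributes [true]. *)
Lemma inv_refl t : reflections S t -> N t t.
Proof.
case=> x [s [Ss tE]].
have tx : t ^ x = s by rewrite conjgE tE mulgVK mulKg.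
have /eqP := invM x x^-1 t; rewrite mulgV inv_1 tx => Nx.
rewrite {1}tE -mulgA !invM tx (inv_gen _ Ss) conjgE.
rewrite (cox_inv Ss) (cox_sq Ss) mulg1 eqxx.
by move: Nx; case: (N x t); case: (N x^-1 s).
Qed.

Lemma inv_reflM t w : reflections S t -> N (t * w) t = ~~ N w t.
Proof. by move=> Tt; rewrite invM inv_refl// conjgE mulKg. Qed.

Lemma inv_genM s w t : S s -> N (s * w) t = (t == s) (+) N w (s * t * s).
Proof. by move=> Ss; rewrite invM inv_gen// conjgE cox_inv// mulgA. Qed.

(** If [t] is the first letter, that letter is deleted; otherwise the search continues in the tail
    with [t] conjugated by it. *)
Lemma strong_exchange a t : word_in S a -> N (wprod a) t ->
  exists a1 s a2, a = a1 ++ s :: a2 /\ t * wprod a = wprod (a1 ++ a2).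
Proof.
elim: a t => [|s a IH] t; first by rewrite wprod_nil inv_1.
move=> /word_in_cons[Ss aS]; rewrite wprod_cons inv_genM//.
have [->|_] := eqVneq t s.
  by move=> _; exists [::], s, a; rewrite cox_mulK.
move=> /(IH _ aS)[a1 [r [a2 [-> E]]]]; exists (s :: a1), r, a2; split=> //.
by rewrite /= wprod_cons -E -!mulgA cox_mulK.
Qed.

Lemma inv_length_lt t w : N w t -> (cox_length S (t * w)%g < cox_length S w)%N.
Proof.
have [a [<- aS <-]] := cox_length_word w.
move=> /(strong_exchange aS)[a1 [s [a2 [aE ->]]]]; rewrite aE in aS *.
have [a1S /word_in_cons[_ a2S]] := (word_in_cat _ _).1 aS.
rewrite size_cat /= addnS ltnS -size_cat; apply: cox_length_le.
exact/word_in_cat.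
Qed.

(** Exactly one of [w] and [t * w] has [t] as an inversion, so [inv_length_lt] applies to
    [t * w]. *)
Lemma notinv_length_gt t w : reflections S t -> ~~ N w t ->
  (cox_length S w < cox_length S (t * w)%g)%N.
Proof.
by move=> Tt; rewrite -inv_reflM// => /inv_length_lt; rewrite reflections_mulK.
Qed.

Lemma cox_length_genM_le s w :
  S s -> (cox_length S (s * w)%g <= (cox_length S w).+1)%N.
Proof.
move=> Ss; have [a [<- aS <-]] := cox_length_word w.
by rewrite -wprod_cons; apply: (@cox_length_le (s :: a)); apply/word_in_cons.
Qed.

Lemma notinv_length_gen s w : S s -> ~~ N w s ->
  cox_length S (s * w) = (cox_length S w).+1.
Proof.
move=> Ss sw; apply/eqP; rewrite eqn_leq cox_length_genM_le//.
by rewrite notinv_length_gt//; apply: reflections_gen.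
Qed.

(** If [t] differs from [s], then [s * t * s] is no inversion of [s * u], so [s * t * u] is longer
    than [s * u], itself longer than [u]; but [s] is an inversion of [t * u], so [s * t * u] is at
    most as long as [u]. *)
Lemma inv_cover_gen s t u : S s -> reflections S t -> ~~ N u s -> ~~ N u t ->
  cox_length S (t * u) = (cox_length S u).+1 -> N (t * u) s -> t = s.
Proof.
move=> Ss Tt us ut lt /inv_length_lt; rewrite lt ltnS => ls.
apply/eqP; apply: contraTT ls => t_s; rewrite -ltnNge.
have sts : ~~ N (s * u) (s * t * s).
  by rewrite inv_genM// genJ_eq// (negbTE t_s) -!mulgA cox_sq// mulg1 cox_mulK.
have : reflections S (s * t * s^-1) by apply: reflections_conj.
rewrite cox_inv// => /notinv_length_gt/(_ sts).
by rewrite -!mulgA (cox_mulK _ Ss) notinv_length_gen// => /ltnW.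
Qed.

Lemma reduced_cons s a : word_in S (s :: a) -> reduced S (s :: a) ->
  reduced S a /\ ~~ N (wprod a) s.
Proof.
move=> /word_in_cons[Ss aS]; rewrite /reduced wprod_cons /= => /eqP E.
have := cox_length_genM_le (wprod a) Ss; have := cox_length_le aS.
split; first by apply/eqP; lia.
by apply/negP => /inv_length_lt; lia.
Qed.

Lemma reduced_cat a b : word_in S (a ++ b) -> reduced S (a ++ b) -> reduced S b.
Proof.
elim: a => //= s a IH abS abr; have [r _] := reduced_cons abS abr.
by apply: IH => //; case/word_in_cons: abS.
Qed.

(** * The subword property of Bruhat order *)

Definition below a v := exists2 c, subseq c a & wprod c = v.

Lemma below_exchange a v t : word_in S a -> below a v -> N v t -> below a (t * v).
Proof.
move=> aS [c ca <-] /strong_exchange[|a1 [s [a2 [cE ->]]]].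
  exact: word_in_subseq ca aS.
exists (a1 ++ a2) => //; apply: subseq_trans ca; rewrite cE.
by rewrite cat_subseq// subseq_cons.
Qed.

(** A subword that uses the first letter becomes a subword of [a] once [s] is dropped; a descent [s]
    that is still present is removed by exchange inside [a]. *)
Lemma below_cons s a v : word_in S (s :: a) -> below (s :: a) v ->
  below a (if N v s then s * v else v).
Proof.
move=> /word_in_cons[Ss aS] [[|x c]] /=.
  by move=> _ <-; rewrite wprod_nil inv_1; exists [::]; rewrite ?sub0seq ?wprod_nil.
case: eqP => [-> ca|_ ca] <-; last first.
  by case: ifP => // Nv; [apply: below_exchange => //|]; exists (x :: c).
rewrite wprod_cons inv_reflM; last exact: reflections_gen.
case: ifPn => [_|/negPn Nc]; first by rewrite cox_mulK//; exists c.
by apply: below_exchange => //; exists c.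
Qed.

(** The parameter [w] is the top: the chain climbs from the index to [w], multiplying on the left by
    reflections that are not inversions. *)
Inductive bruhat_le (w : W) : W -> Prop :=
  | bruhat_refl : bruhat_le w w
  | bruhat_step u t : reflections S t -> ~~ N u t ->
      bruhat_le w (t * u) -> bruhat_le w u.

Lemma bruhat_le_refl_trans u w t : reflections S t -> ~~ N w t ->
  bruhat_le w u -> bruhat_le (t * w) u.
Proof.
move=> Tt wt; elim=> [|v r Tr vr _ IH]; last exact: bruhat_step IH.
by apply: (bruhat_step Tt wt); apply: bruhat_refl.
Qed.

(** Conjugating the reflections of a chain by [s] translates the chain, except at a step by [s]
    itself; there [s * v] is already below [w], hence below [s * w]. *)
Lemma bruhat_le_genM s u w : S s -> ~~ N w s ->
  bruhat_le w u -> bruhat_le (s * w) (s * u).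
Proof.
move=> Ss ws; have Ts := reflections_gen Ss.
elim=> [|v t Tt vt vw IH]; first exact: bruhat_refl.
have [ts|t_s] := eqVneq t s.
  by rewrite ts in vw; apply: bruhat_le_refl_trans.
apply: (@bruhat_step _ _ (s * t * s)).
- by have := reflections_conj s Tt; rewrite cox_inv.
- by rewrite inv_genM// genJ_eq// (negbTE t_s) -!mulgA cox_sq// mulg1 cox_mulK.
- by rewrite -!mulgA cox_mulK.
Qed.

(** Each step of the chain, read downwards, is an exchange inside a subword of [a]. *)
Lemma bruhat_le_below a v w : word_in S a -> bruhat_le w v -> below a w -> below a v.
Proof.
move=> aS; elim=> // u t Tt ut _ IH /IH tu.
by rewrite -(reflections_mulK u Tt); apply: below_exchange; rewrite ?inv_reflM.
Qed.

Lemma below_bruhat_le a v : word_in S a -> reduced S a -> below a v ->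
  bruhat_le (wprod a) v.
Proof.
elim: a v => [|s a IH] v aS ar [c].
  by rewrite subseq0 => /eqP-> <-; apply: bruhat_refl.
have [ar' sa] := reduced_cons aS ar; have [Ss aS'] := (word_in_cons s a).1 aS.
rewrite wprod_cons; case: c => [_ <-|x c /=].
  apply: bruhat_le_refl_trans => //; first exact: reflections_gen.
  by apply: IH => //; exists [::]; rewrite ?sub0seq.
case: eqP => [-> ca <-|_ ca <-].
  by rewrite wprod_cons; apply: bruhat_le_genM => //; apply: IH => //; exists c.
apply: bruhat_le_refl_trans => //; first exact: reflections_gen.
by apply: IH => //; exists (x :: c).
Qed.

(** The lower interval depends on the element and not on the word chosen for it; [bruhat_le] is the
    word-free intermediary. *)
Lemma below_reduced a b v : word_in S a -> word_in S b -> reduced S a ->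
  wprod a = wprod b -> below a v -> below b v.
Proof.
move=> aS bS ar ab /(below_bruhat_le aS ar) va.
by apply: (bruhat_le_below bS va); rewrite ab; exists b.
Qed.

(** * Sorted subwords *)

Section SortedSubwords.
Variables (m : nat) (f : nat -> W).
Hypothesis fS : forall i, (i < m)%N -> S (f i).
Implicit Types (P A B : pred nat) (i j k n : nat).

(** Positions are naturals and subwords are predicates, so that intervals of positions split without
    casts between ordinal types. *)
Definition letters A j n := [seq f i | i <- index_iota j n & A i].

Lemma letters_geq A j n : (n <= j)%N -> letters A j n = [::].
Proof. by move=> nj; rewrite /letters /index_iota (eqP nj). Qed.

Lemma letters_ltn A j n : (j < n)%N ->
  letters A j n = if A j then f j :: letters A j.+1 n else letters A j.+1 n.
Proof. by move=> jn; rewrite /letters /index_iota -(subnSK jn) /=; case: (A j). Qed.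

Lemma letters_cat A j k n : (j <= k <= n)%N ->
  letters A j n = letters A j k ++ letters A k n.
Proof.
move=> /andP[jk kn]; rewrite /letters -map_cat -filter_cat; congr (map _ (filter _ _)).
by rewrite /index_iota -{2}(subnKC jk) -iotaD; congr iota; lia.
Qed.

Lemma eq_letters A B j n : (forall i, (j <= i < n)%N -> A i = B i) ->
  letters A j n = letters B j n.
Proof.
move=> AB; congr map; apply: eq_in_filter => i.
by rewrite mem_index_iota => /AB.
Qed.

Lemma letters_subseq A B j n : (forall i, (j <= i < n)%N -> A i -> B i) ->
  subseq (letters A j n) (letters B j n).
Proof.
move=> AB; apply: map_subseq.
rewrite [X in subseq X](_ : _ = filter A (filter B (index_iota j n))).
  exact: filter_subseq.
rewrite -filter_predI; apply: eq_in_filter => i; rewrite mem_index_iota => /AB /=.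
by case: (A i) => // ->.
Qed.

Lemma letters_in A j n : (n <= m)%N -> word_in S (letters A j n).
Proof.
move=> nm s /mapP[i]; rewrite mem_filter mem_index_iota => /and3P[_ _ il] ->.
exact: fS (leq_trans il nm).
Qed.

Lemma letters_nil A j n : letters A j n = [::] -> forall i, (j <= i < n)%N -> ~~ A i.
Proof.
move=> A0 i ijn; apply/negP => Ai.
have : f i \in letters A j n by apply: map_f; rewrite mem_filter Ai mem_index_iota.
by rewrite A0.
Qed.

(** [P] is the set of positions offered to the greedy choice: [predT] gives the sorted sets, [P = A]
    only says that [A] is reduced on the interval. *)
Definition sorted_on P A j n :=
  forall i, (j <= i < n)%N -> P i -> ~~ N (wprod (letters A i.+1 n)) (f i).

Lemma sorted_onS P A j k n : (j <= k)%N -> sorted_on P A j n -> sorted_on P A k n.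
Proof. by move=> jk Aj i /andP[ki il]; apply: Aj; rewrite (leq_trans jk). Qed.

Lemma sorted_on_reduced P A j n : (n <= m)%N ->
  (forall i, (j <= i < n)%N -> A i -> P i) ->
  sorted_on P A j n -> reduced S (letters A j n).
Proof.
move=> nm; move En : (n - j)%N => d.
elim: d => [|d IH] in j En * => AP Aj.
  by rewrite letters_geq -?subn_eq0 ?En// /reduced wprod_nil cox_length1.
have jn : (j < n)%N by rewrite -subn_gt0 En.
have /eqP E : reduced S (letters A j.+1 n).
  apply: IH; [by rewrite subnS En | | exact: sorted_onS Aj].
  by move=> i /andP[ji il]; apply: AP; rewrite ltnW.
rewrite letters_ltn//; case: ifP => [Aj1|_]; last by rewrite /reduced E.
rewrite /reduced wprod_cons /= E notinv_length_gen//; last first.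
  by apply: Aj; [|apply: AP]; rewrite ?leqnn.
by apply: fS; apply: leq_trans nm.
Qed.

(** If [f i] shortened the product up to [k], the remaining letters could not make up for the loss,
    although [f i] lengthens the reduced product up to [n]. *)
Lemma sorted_on_prefix P A j k n : (k <= n <= m)%N ->
  (forall i, (j <= i < n)%N -> A i -> P i) ->
  sorted_on P A j n -> sorted_on P A j k.
Proof.
move=> /andP[kn nm] AP Aj i /andP[ji ik] Pi.
have im : (i < m)%N by lia.
have E := @letters_cat A i.+1 k n; rewrite ik kn in E; have {}E := E isT.
have /eqP : reduced S (letters A i.+1 n).
  apply: (@sorted_on_reduced P) => //; last by apply: sorted_onS Aj; lia.
  by move=> l /andP[il ln]; apply: AP; lia.
have := @notinv_length_gen _ (wprod (letters A i.+1 n)) (fS im).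
rewrite Aj ?ji ?(leq_trans ik)// => /(_ isT).
rewrite E wprod_cat size_cat => l1 l2; apply/negP => /inv_length_lt.
have := cox_length_le (@letters_in A i.+1 k (leq_trans kn nm)).
have := cox_length_le (@letters_in A k n nm).
have := cox_lengthM_le (f i * wprod (letters A i.+1 k)) (wprod (letters A k n)).
by rewrite -mulgA l1 -l2; lia.
Qed.

(* Reading the letters from left to right, a sorted subword takes a letter iff
   it is a left descent of what remains to be written: it is finished as soon
   as this is possible. *)
Lemma sorted_on_below P A j k n : (j <= k)%N -> (k <= n <= m)%N ->
  (forall i, (j <= i < n)%N -> A i -> P i) -> sorted_on P A j n ->
  below (letters P j k) (wprod (letters A j n)) ->
  forall i, (k <= i < n)%N -> ~~ A i.
Proof.
move=> jk /andP[kn nm]; move Ek : (k - j)%N => d.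
elim: d => [|d IH] in j jk Ek * => AP Aj.
  have {jk Ek}<- : j = k by lia.
  rewrite letters_geq// => -[c]; rewrite subseq0 => /eqP-> /esym/eqP.
  rewrite wprod_nil => /eqP w1; apply: letters_nil; apply: size0nil.
  by have /eqP-> := sorted_on_reduced nm AP Aj; rewrite w1 cox_length1.
have jk' : (j < k)%N by lia.
have jm : (j < m)%N by lia.
have jn : (j < n)%N by lia.
rewrite (letters_ltn _ jk') (letters_ltn _ jn) => vb; apply: IH jk' _ _ _ _; first lia.
- by move=> i /andP[ji il]; apply: AP; rewrite ltnW.
- exact: sorted_onS Aj.
case: ifP vb => [Pj|/negbT Pj]; last by rewrite (contraNF (AP j _)) ?leqnn.
(* Since [f j] is no descent of what follows, it is a descent of the product from [j] on exactly
   when [A j]; so [below_cons] strips the same letter as [A] does. *)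
have := Aj j _ Pj; rewrite leqnn jn => /(_ isT) Nj.
have Sj := fS jm; have Tj := reflections_gen Sj.
have PS : word_in S (f j :: letters P j.+1 k).
  by apply/word_in_cons; split=> //; apply: letters_in; apply: leq_trans nm.
move/(below_cons PS).
by case: (A j); rewrite ?wprod_cons ?inv_reflM ?(negbTE Nj)//= ?cox_mulK.
Qed.



Lemma sorted_on_adjoin A B (x : nat) :
  sorted_on predT A 0 m -> sorted_on predT B 0 m ->
  (x < m)%N -> B x -> ~~ A x -> (forall i, (i < x)%N -> B i -> A i) ->
  sorted_on predT (predU1 x A) 0 m.
Proof.
move=> sA sB xm Bx Ax BA; pose A' : pred nat := predU1 x A.
have A'A i : i != x -> A' i = A i by rewrite /A' /= => /negbTE->.
have A'x : A' x by rewrite /A' /= eqxx.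
have BA' k : (k < x.+1)%N -> B k -> A' k.
  by rewrite ltnS leq_eqVlt => /predU1P[->//|kx] /(BA _ kx) Ak; rewrite /A' /= Ak orbT.
(* Induction on the distance to [x]: when [i] is examined, every later position of [A'] is known to
   be good. *)
move=> i /andP[_ im] _; have [d] := ubnP (x - i).
elim: d => // d IH in i im * => xi.
have [xi'|ix] := leqP x i.
  rewrite (@eq_letters _ A); first by apply: sA.
  by move=> k /andP[ik _]; apply: A'A; lia.
have {IH}sA' : sorted_on predT A' i.+1 m.
  by move=> k /andP[ik km] _; apply: IH => //; lia.
apply/negP => Ns; have Ss := fS im.
pose p := letters A i.+1 x; pose q := letters A x.+1 m.
have EA : letters A i.+1 m = p ++ q.
  by rewrite (@letters_cat A i.+1 x m) ?ix ?(ltnW xm)// (letters_ltn _ xm) (negbTE Ax).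
have EA'p : letters A' i.+1 x = p.
  by apply: eq_letters => k /andP[_ kx]; apply: A'A; lia.
have EA'x : letters A' i.+1 x.+1 = p ++ [:: f x].
  rewrite (@letters_cat A' i.+1 x x.+1) ?ix ?leqnSn// EA'p.
  by rewrite letters_ltn// A'x letters_geq.
have EA' : letters A' i.+1 m = p ++ f x :: q.
  rewrite (@letters_cat A' i.+1 x.+1 m) ?EA'x ?ltnS ?(ltnW ix)// -catA; congr (_ ++ _ :: _).
  by apply: eq_letters => k /andP[xk _]; apply: A'A; lia.
have rA : reduced S (p ++ q).
  by rewrite -EA; apply: (@sorted_on_reduced predT) => //; apply: sorted_onS sA.
have rA' : reduced S (p ++ f x :: q).
  by rewrite -EA'; apply: (@sorted_on_reduced predT).
(* The adjoined letter carried to the left of [p]: adjoining [x] multiplies the product of [A] after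
   [i] on the left by [t]. *)
pose t := wprod p * f x * (wprod p)^-1.
have Tt : reflections S t by exists (wprod p), (f x); split=> //; apply: fS.
have tpq : wprod (p ++ f x :: q) = t * wprod (p ++ q).
  by rewrite !wprod_cat wprod_cons /t -!mulgA mulKg.
have lt : cox_length S (t * wprod (p ++ q)) = (cox_length S (wprod (p ++ q))).+1.
  by rewrite -tpq -(eqP rA) -(eqP rA') !size_cat addnS.
(* Both words are reduced, so [t] gives a cover; [f i] is an ascent below it and a descent above
   it. *)
have {lt}ts : t = f i.
  apply: (inv_cover_gen Ss Tt _ _ lt); first by rewrite -EA; apply: sA.
    by apply/negP => /inv_length_lt; rewrite lt; lia.
  by rewrite -tpq -EA'.
have spx : wprod (p ++ [:: f x]) = wprod (f i :: p).
  by rewrite -ts wprod_cat !wprod_cons wprod_nil mulg1 /t mulgVK.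
pose v := wprod (letters B i.+1 x.+1).
have sBx : sorted_on predT B 0 x.+1.
  by apply: (@sorted_on_prefix _ _ _ _ m); rewrite ?xm ?leqnn.
have vs : ~~ N v (f i) by apply: sBx; rewrite ?ltnS ?(ltnW ix).
have pS : word_in S p by apply: letters_in; apply: ltnW.
have : below p v.
  have sp : word_in S (f i :: p) by apply/word_in_cons.
  suff /(below_cons sp) : below (f i :: p) v by rewrite (negbTE vs).
  apply: (@below_reduced (p ++ [:: f x])) => //.
  - by rewrite -EA'x; apply: letters_in.
  - rewrite -EA'x; apply: (@sorted_on_reduced predT) => //.
    by apply: (@sorted_on_prefix _ _ _ _ m); rewrite ?xm ?leqnn.
  - exists (letters B i.+1 x.+1) => //; rewrite -EA'x; apply: letters_subseq => k /andP[_].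
    exact: BA'.
(* With [x] as bound and [x.+1] as end, the only position excluded from [B] is [x] itself, which
   contradicts [Bx]. *)
rewrite -EA'p => bp; have := @sorted_on_below A' B i.+1 x x.+1 ix.
rewrite leqnSn xm => /(_ isT) H; apply: (negP (H _ _ bp x _)) => //.
- by move=> k /andP[_]; apply: BA'.
- by move=> k /andP[ik kx] _; apply: sBx.
- by rewrite leqnn ltnSn.
Qed.

(** Greedy construction: a letter is taken iff it is a left descent of what remains to be written,
    and [below_cons] keeps the remainder writable in the later positions. *)
Lemma sorted_on_exists v j : below (letters predT j m) v ->
  exists2 A : pred nat, sorted_on predT A j m & wprod (letters A j m) = v.
Proof.
move Ed: (m - j)%N => d; elim: d => [|d IH] in j v Ed *.
  have mj : (m <= j)%N by lia.
  rewrite letters_geq// => -[c]; rewrite subseq0 => /eqP-> <-.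
  by exists predT; [move=> i; lia | rewrite letters_geq].
have jm : (j < m)%N by lia.
have Sj := fS jm; have Tj := reflections_gen Sj.
rewrite letters_ltn//= => vb.
have /IH [|A sA Av] :
    below (letters predT j.+1 m) (if N v (f j) then f j * v else v).
- by apply: below_cons vb; apply/word_in_cons; split=> //; apply: letters_in.
- by rewrite subnS Ed.
pose A' i := if i == j then N v (f j) else A i.
have A'A i : (j < i)%N -> letters A' i m = letters A i m.
  move=> ji; apply: eq_letters => k /andP[ik _]; rewrite /A'.
  by case: eqP => // kj; lia.
exists A'; last first.
  rewrite letters_ltn// A'A// /A' eqxx.
  by case: ifP Av => _ Av; rewrite ?wprod_cons Av ?cox_mulK.
move=> i /andP[]; rewrite leq_eqVlt => /predU1P[<- _ _|ji im _]; last first.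
  by rewrite A'A; [apply: sA; rewrite ?ji | apply: ltnW].
rewrite A'A// Av; case: ifP => [Nv|/negbT//].
by rewrite inv_reflM ?Nv.
Qed.

(** If [B] took the letter at the first difference and [A] did not, cancelling the common prefix
    would leave equal products with [f i] as a descent, against the sortedness of [A]. *)
Lemma sorted_on_lex A B i : sorted_on predT A 0 m -> reduced S (letters B 0 m) ->
  wprod (letters A 0 m) = wprod (letters B 0 m) -> (i < m)%N ->
  (forall k, (k < i)%N -> A k = B k) -> A i != B i -> A i.
Proof.
move=> sA rB AB im eqAB; case Ai: (A i) => //; case Bi: (B i) => // _; exfalso.
move: AB rB; have BS := @letters_in B 0 m (leqnn _); move: BS.
rewrite !(@letters_cat _ 0 i m) ?(ltnW im)// (@eq_letters A B 0 i); last first.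
  by move=> k /andP[_]; apply: eqAB.
move=> BS; rewrite !wprod_cat => /mulgI.
rewrite !(letters_ltn _ im) Ai Bi in BS * => AB /(reduced_cat BS).
case/word_in_cat: BS => _ BS /(reduced_cons BS)[_ ].
rewrite -(inv_reflM _ (reflections_gen (fS im))) -wprod_cons -AB.
by apply/negP; apply: sA; rewrite ?im.
Qed.

End SortedSubwords.

End Inversions.
End Coxeter.

(** * Adding relations to a supersolvable antimatroid *)

Section SupersolvableAntimatroid.
Variables (m : nat) (T : Type) (idx : T -> {set 'I_m}).
Hypothesis idx_inj : injective idx.
Hypothesis idx_set0 : exists u, idx u = finset.set0.
Hypothesis idx_adjoin : forall u v (x : 'I_m), x \in idx v -> x \notin idx u ->
  (forall i : 'I_m, (i < x)%N -> i \in idx v -> i \in idx u) ->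
  exists z, idx z = x |: idx u.
Hypothesis idx_prefix : forall u (x : 'I_m),
  exists z, idx z = [set i in idx u | (i <= x)%N]%SET.

Let le u v : Prop := idx u \subset idx v.

Lemma min_setD (A B : {set 'I_m}) : ~~ (A \subset B) ->
  exists x, [/\ x \in A, x \notin B &
    forall i : 'I_m, (i < x)%N -> i \in A -> i \in B].
Proof.
case/subsetPn => x0 x0A x0B.
have D0 : x0 \in A :\: B by rewrite inE x0B.
case: (@arg_minnP _ x0 (mem (A :\: B)) val D0) => x /=.
rewrite inE => /andP[xB xA] minx; exists x; split=> // i ix iA.
by apply: contraTT ix => iB; rewrite -leqNgt; apply: minx; rewrite inE iB.
Qed.

(** The least element of [idx v] still missing is adjoined repeatedly. *)
Lemma idx_setU u v : exists z, idx z = idx u :|: idx v.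
Proof.
have [n] := ubnP #|idx v :\: idx u|.
elim: n u => // n IH u un.
have [vu|/min_setD[x [xv xu xmin]]] := boolP (idx v \subset idx u).
  by exists u; apply/esym/finset.setUidPl.
have [z zE] := idx_adjoin xv xu xmin.
have [|y yE] := IH z; last first.
  exists y; rewrite yE zE -finset.setUA finset.setUCA.
  by congr (_ :|: _); apply/finset.setUidPr; rewrite finset.sub1set.
move: un; rewrite zE (cardsD1 x (idx v :\: idx u)) inE xv xu add1n ltnS.
by rewrite finset.setDDl finset.setUC.
Qed.

(** Joins are unions. The meet is an index set of greatest cardinality inside the intersection;
    closure under union makes it contain all the others. *)
Lemma sub_is_lattice : is_lattice le.
Proof.
split.
- split.
  + by move=> u; rewrite /le.
  + by move=> u v w; apply: fintype.subset_trans.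
  + move=> u v uv vu; apply: idx_inj; apply/eqP.
    by rewrite finset.eqEsubset; apply/andP.
- move=> u v; have [z zE] := idx_setU u v; exists z.
  split=> [||y uy vy]; rewrite /le zE
    ?finset.subsetUl ?finset.subsetUr// finset.subUset; exact/andP.
- move=> u v; have [z0 z0E] := idx_set0.
  pose P (A : {set 'I_m}) := `[< exists z, idx z = A >] && (A \subset idx u :&: idx v).
  have P0 : P finset.set0 by rewrite /P finset.sub0set andbT; apply/asboolP; exists z0.
  case: (@arg_maxnP _ finset.set0 P (fun A => #|A|) P0) => A.
  case/andP=> /asboolP[z <-]; rewrite finset.subsetI => /andP[zu zv] zmax.
  exists z; split=> // y yu yv; have [x xE] := idx_setU z y.
  have /zmax : P (idx z :|: idx y).
    apply/andP; split; first by apply/asboolP; exists x.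
    by rewrite finset.subsetI !finset.subUset zu zv (yu : _ \subset _) (yv : _ \subset _).
  move=> card_le; have /eqP zy : idx z == idx z :|: idx y by rewrite eqEcard finset.subsetUl.
  by rewrite /le zy finset.subsetUr.
Qed.

Section AddRelations.
Variable C : set (T * T).
Hypothesis C_cover : forall u w, C (u, w) -> #|idx w| = #|idx u|.+1 /\ ~ le u w.

Let leC := add_relations le C.

(** Both kinds of generating relation increase the rank, apart from equality; antisymmetry of the
    closure follows. *)
Lemma add_relations_rank u v : leC u v -> u = v \/ (#|idx u| < #|idx v|)%N.
Proof.
elim=> {u v} [u v [uv|/C_cover[->]]|u w v _ IH1 _ IH2]; last 2 first.
- by right.
- by case: IH1 IH2 => [->|uw] [<-|wv]; [left|right|right|right; apply: ltn_trans wv].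
have [E|lt] := eqVproper uv; first by left; apply: idx_inj.
by right; apply: proper_card.
Qed.

Lemma add_relations_poset : is_poset leC.
Proof.
split=> [u|u v w|u v uv vu];
  first by apply: Relation_Operators.t_step; left; rewrite /le.
- exact: Relation_Operators.t_trans.
- by case: (add_relations_rank uv) (add_relations_rank vu) => [->//|uv'] [->//|vu']; lia.
Qed.

(** An added relation ends at rank above [n], so no chain ending at rank at most [n] can use one. *)
Lemma add_relations_below n : (forall u w, C (u, w) -> n <= #|idx u|)%N ->
  forall u v, leC u v -> (#|idx v| <= n)%N -> le u v.
Proof.
move=> Cn u v; elim=> {u v} [u v [//|/[dup] uv /C_cover[-> _]] vn|u w v _ IH1 wv IH2 vn].
  by have := Cn _ _ uv; lia.
apply: (@fintype.subset_trans _ (idx u) (idx w) (idx v)); last exact: IH2.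
by apply: IH1; case: (add_relations_rank wv) => [->//|wv']; lia.
Qed.

(* Take [(u, w)] in [C] with [u] of least rank, [y] the first index of [w]
   missing in [u], and [p] the prefix of [w] ending at [y]: both [w] and
   [u + y] are upper bounds of [u] and [p], just one rank above [u]. *)
Lemma add_relations_not_lattice : C !=set0 -> ~ is_lattice leC.
Proof.
move=> [[u0 w0] C0] [_ join _].
have exC : exists n, `[< exists u w, C (u, w) /\ #|idx u| = n >].
  by exists #|idx u0|; apply/asboolP; exists u0, w0.
case: (ex_minnP exC) => n /asboolP[u [w [Cuw un]]] minn.
have Cn u' w' : C (u', w') -> (n <= #|idx u'|)%N.
  by move=> Cu'; apply: minn; apply/asboolP; exists u', w'.
have [cw uw] := C_cover Cuw.
have wu : ~~ (idx w \subset idx u).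
  by apply/negP => /subset_leq_card; rewrite cw ltnn.
have [y [yw yu ymin]] := min_setD wu.
have [d dE] := idx_adjoin yw yu ymin; have [p pE] := idx_prefix w y.
have le_leC a b : le a b -> leC a b.
  by move=> ab; apply: Relation_Operators.t_step; left.
have pw : leC p w.
  by apply: le_leC; rewrite /le pE; apply/fintype.subsetP => i; rewrite inE => /andP[].
have ud : leC u d by apply: le_leC; rewrite /le dE finset.subsetUr.
have pd : leC p d.
  apply: le_leC; rewrite /le pE dE.
  apply/fintype.subsetP => i; rewrite !inE => /andP[iw].
  by rewrite leq_eqVlt => /orP[/eqP/val_inj->|/ymin->//]; rewrite ?eqxx ?orbT.
have uw' : leC u w by apply: Relation_Operators.t_step; right.
have cd : #|idx d| = #|idx u|.+1 by rewrite dE cardsU1 yu.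
have [z [uz pz zmin]] := join u p.
have := add_relations_rank (zmin _ ud pd); have := add_relations_rank (zmin _ uw' pw).
(* If [z] is strictly above [u], its rank is at least that of [w] and of [d], so [z] equals both,
   although [d] contains [u] and [w] does not. There remains [z = u], where minimality of the rank
   puts [p], and with it [y], inside [u]. *)
have := add_relations_rank uz; case=> [uzE _ _|uz']; last first.
  case=> [zw|]; last by lia.
  case=> [zd|]; last by lia.
  by apply: uw; rewrite /le -zw zd dE finset.subsetUr.
have : le p u by apply: (add_relations_below Cn); rewrite ?un// uzE.
rewrite /le => /fintype.subsetP/(_ y); rewrite pE inE yw leqnn => /(_ isT).
by apply/negP.
Qed.

End AddRelations.
End SupersolvableAntimatroid.

(** * The index sets of the sorted words *)

Section SortIndex.
Variables (W : groupType) (S : set W) (m : nat) (omega : m.-tuple W).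
Hypothesis coxS : coxeter_system S.
Hypothesis omegaS : forall i : 'I_m, S (tnth omega i).
Variable N : W -> W -> bool.
Hypothesis inv_gen : forall s t, S s -> N s t = (t == s).
Hypothesis invM : forall u v t, N (u * v) t = N u t (+) N v (t ^ u).
Implicit Types A B : {set 'I_m}.

Definition index_pred A : pred nat := fun i => i \in [seq val k | k in A].

Definition index_set (P : pred nat) : {set 'I_m} := [set i : 'I_m | P i]%SET.

Let f := nth 1 omega.

Lemma index_predE A (i : 'I_m) : index_pred A i = (i \in A).
Proof. by rewrite /index_pred (mem_map val_inj) mem_enum. Qed.

Lemma index_setK (P : pred nat) i : (i < m)%N -> index_pred (index_set P) i = P i.
Proof. by move=> im; rewrite (index_predE _ (Ordinal im)) inE. Qed.

Lemma nth_omegaS i : (i < m)%N -> S (f i).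
Proof. by move=> im; have := omegaS (Ordinal im); rewrite (tnth_nth 1). Qed.

Lemma subword_letters A : subword omega A = letters f (index_pred A) 0 m.
Proof.
rewrite /subword /letters /index_iota subn0 -val_enum_ord filter_map -map_comp.
rewrite (eq_map (g := f \o val)); last by move=> i; rewrite /= (tnth_nth 1).
congr map; rewrite enumT {1}/enum_mem; apply: eq_filter => i.
by rewrite /= index_predE.
Qed.

Definition sorted_set A := sorted_on N f predT (index_pred A) 0 m.

Lemma eq_sorted (P Q : pred nat) : (forall i, (i < m)%N -> P i = Q i) ->
  sorted_on N f predT P 0 m -> sorted_on N f predT Q 0 m.
Proof.
move=> PQ sP i im _; rewrite -(@eq_letters _ f P); first exact: sP.
by move=> k /andP[_]; apply: PQ.
Qed.

Lemma sorted_reduced A : sorted_set A -> reduced S (subword omega A).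
Proof.
move=> sA; rewrite subword_letters.
by apply: (sorted_on_reduced coxS inv_gen invM nth_omegaS (leqnn m) _ sA).
Qed.

Lemma sorted_set_exists u : subword_products omega u ->
  exists2 A, sorted_set A & wprod (subword omega A) = u.
Proof.
case/existsP => B /eqP; rewrite subword_letters => Bu.
have /(sorted_on_exists coxS inv_gen invM nth_omegaS)[P sP Pu] :
    below (letters f predT 0 m) u.
  by exists (letters f (index_pred B) 0 m) => //; apply: letters_subseq.
have PE i : (i < m)%N -> P i = index_pred (index_set P) i.
  by move=> im; rewrite index_setK.
exists (index_set P); first exact: eq_sorted sP.
by rewrite subword_letters -Pu; congr wprod; apply: eq_letters => i /PE.
Qed.

(** At the least element of the symmetric difference, [sorted_on_lex] shows that it is [A] that
    takes the letter. *)
Lemma sorted_set_spec A :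
  sorted_set A -> sort_spec S omega (wprod (subword omega A)) A.
Proof.
move=> sA; apply/andP; split; first by rewrite /reduced_for sorted_reduced/=.
apply/forallP => B; apply/implyP => /andP[rB /eqP BA].
rewrite /lex_le; have [//|AB] := eqVneq A B; set D := _ :\: _.
have DE i : (i \in D) = ((i \in A) != (i \in B)).
  by rewrite !inE; case: (i \in A); case: (i \in B).
have [i0 i0D] : exists i, i \in D.
  apply/existsP; apply: contraNT AB => /existsPn D0; apply/eqP/setP => i.
  by have := D0 i; rewrite DE negbK => /eqP.
case: (@arg_minnP _ i0 (mem D) val i0D) => i iD imin.
apply/orP; right; apply/existsP; exists i; rewrite [_ \in _]iD /=; apply/andP; split.
  by apply/forallP => j; apply/implyP; apply: imin.
rewrite -index_predE.
apply: (sorted_on_lex coxS inv_gen invM nth_omegaS sA (B := index_pred B)).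
- by rewrite -subword_letters.
- by rewrite -!subword_letters.
- exact: ltn_ord.
- move=> k ki; have km := ltn_trans ki (ltn_ord i).
  rewrite !(index_predE _ (Ordinal km)); apply/eqP; apply: contraTT ki.
  by rewrite -DE -leqNgt; apply: imin.
- by rewrite !index_predE -DE.
Qed.

Lemma lex_le_anti A B : lex_le A B -> lex_le B A -> A = B.
Proof.
rewrite /lex_le finset.setUC finset.setIC; case/orP=> [/eqP//|].
case/existsP=> i /and3P[iD /forallP imin iA]; case/orP=> [/eqP//|].
case/existsP=> j /and3P[jD /forallP jmin jB].
have ij : i = j.
  by apply/val_inj/eqP; rewrite eqn_leq (implyP (imin j))// (implyP (jmin i)).
by rewrite -ij in jB; move: iD; rewrite !inE iA jB.
Qed.

(** [pick] returns some set meeting [sort_spec]; antisymmetry of [lex_le] identifies it with [A]. *)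
Lemma sorted_sort_idx A :
  sorted_set A -> sort_idx S omega (wprod (subword omega A)) = A.
Proof.
move=> /sorted_set_spec sA; rewrite /sort_idx.
case: pickP => [B sB|/(_ A)]; last by rewrite sA.
move: sA sB => /andP[rA /forallP minA] /andP[rB /forallP minB] /=.
by apply: lex_le_anti; [apply: (implyP (minB A)) | apply: (implyP (minA B))].
Qed.

Let idx (u : W_ omega) := sort_idx S omega (sval u).

Lemma idx_sorted u : sorted_set (idx u) /\ wprod (subword omega (idx u)) = sval u.
Proof.
by have [A sA Au] := sorted_set_exists (proj2_sig u); rewrite /idx -Au sorted_sort_idx.
Qed.

Lemma sorted_idx A : sorted_set A -> exists u, idx u = A.
Proof.
move=> sA; have pA : subword_products omega (wprod (subword omega A)).
  by apply/existsP; exists A.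
by exists (exist (fun u => subword_products omega u) _ pA); apply: sorted_sort_idx.
Qed.

Lemma sorted_idx_inj : injective idx.
Proof.
move=> u v uv; apply/val_inj; change (sval u = sval v).
by rewrite -(idx_sorted u).2 uv (idx_sorted v).2.
Qed.

Lemma card_sorted_idx u : #|idx u| = cox_length S (sval u).
Proof.
have [sA Au] := idx_sorted u; have /eqP := sorted_reduced sA.
by rewrite Au /subword size_map -cardE.
Qed.

Lemma sorted_idx_set0 : exists u, idx u = finset.set0.
Proof.
apply: sorted_idx => i _ _; rewrite (@eq_letters _ f _ pred0); last first.
  by move=> k /andP[_ km]; rewrite (index_predE _ (Ordinal km)) inE.
by rewrite /letters filter_pred0 wprod_nil (inv_1 invM).
Qed.

Lemma sorted_idx_adjoin u v (x : 'I_m) : x \in idx v -> x \notin idx u ->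
  (forall i : 'I_m, (i < x)%N -> i \in idx v -> i \in idx u) ->
  exists z, idx z = x |: idx u.
Proof.
move=> xv xu uv; apply: sorted_idx.
have [su _] := idx_sorted u; have [sv _] := idx_sorted v.
apply: (@eq_sorted (predU1 (x : nat) (index_pred (idx u)))).
  by move=> i im; rewrite (index_predE _ (Ordinal im)) !inE /=
    (index_predE _ (Ordinal im)).
apply: (sorted_on_adjoin coxS inv_gen invM nth_omegaS su sv) => [|||i ix].
- exact: ltn_ord.
- by rewrite index_predE.
- by rewrite index_predE.
- have im := ltn_trans ix (ltn_ord x).
  by rewrite !(index_predE _ (Ordinal im)); apply: uv.
Qed.

Lemma sorted_idx_prefix u (x : 'I_m) :
  exists z, idx z = [set i in idx u | (i <= x)%N]%SET.
Proof.
apply: sorted_idx; have [su _] := idx_sorted u.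
have xm : (x.+1 <= m <= m)%N by rewrite ltn_ord leqnn.
have sx := sorted_on_prefix coxS inv_gen invM nth_omegaS xm (fun i _ _ => isT) su.
pose B : pred nat := fun i => index_pred (idx u) i && (i <= x)%N.
apply: (@eq_sorted B).
  by move=> i im; rewrite (index_predE _ (Ordinal im)) !inE /B /=
    (index_predE _ (Ordinal im)).
have B0 j : (x < j)%N -> letters f B j m = [::].
  move=> xj; rewrite (@eq_letters _ f _ pred0) /letters ?filter_pred0// => k /andP[jk _].
  by rewrite /B leqNgt (leq_trans xj jk) andbF.
(* Beyond [x] no letter remains and the product is [1], which has no inversions; up to [x] the
   prefix lemma applies. *)
move=> i im _; have [xi|ix] := ltnP x i.
  by rewrite B0 ?wprod_nil ?(inv_1 invM)// ltnW.
rewrite (@letters_cat _ f B i.+1 x.+1 m) ?ltnS ?ix ?ltn_ord// (B0 x.+1)// cats0.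
rewrite (@eq_letters _ f B (index_pred (idx u))); first by apply: sx; rewrite ?ltnS.
by move=> k /andP[_ kx]; rewrite /B -ltnS kx andbT.
Qed.

End SortIndex.

Theorem mainTheorem9 (W : groupType) (S : set W) (m : nat)
    (omega : m.-tuple W) :
  coxeter_system S ->
  (forall i : 'I_m, S (tnth omega i)) ->
  is_lattice (@sorting_le W S m omega) /\
  forall C : set (W_ omega * W_ omega),
    C !=set0 ->
    (forall u w : W_ omega, C (u, w) ->
       bruhat_cover S (sval u) (sval w) /\ ~ sorting_le S u w) ->
    is_poset (add_relations (@sorting_le W S m omega) C) /\
    ~ is_lattice (add_relations (@sorting_le W S m omega) C).
Proof.
move=> coxS omegaS; have [N [inv_gen invM]] := inversions_exist coxS.
have idxI := sorted_idx_inj coxS omegaS inv_gen invM.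
have idx0 := sorted_idx_set0 coxS omegaS inv_gen invM.
have idxA := sorted_idx_adjoin coxS omegaS inv_gen invM.
have idxP := sorted_idx_prefix coxS omegaS inv_gen invM.
split; first exact: sub_is_lattice idxI idx0 idxA.
move=> C C0 Ccov.
(* The cardinality of the index set is the length, so a Bruhat cover raises the rank by one. *)
have Crank u w : C (u, w) ->
    #|sort_idx S omega (sval w)| = #|sort_idx S omega (sval u)|.+1 /\
    ~ (sort_idx S omega (sval u) \subset sort_idx S omega (sval w)).
  move=> /Ccov[[_ lw] nuw]; split=> //.
  by rewrite !(card_sorted_idx coxS omegaS inv_gen invM).
split; first exact: (add_relations_poset idxI Crank).
exact: (add_relations_not_lattice idxI idxA idxP Crank C0).
Qed.
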